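(* If $(A_m)_{m=0}^\infty$ is an Appell sequence, then the expected value of the Wronskian Appell polynomials over partitions of $n$ with respect to Plancherel measure is \[ \mathbb{E}(A_\lambda:\lambda\vdash n)=\sum_{\lambda\vdash n}\frac{F_\lambda^2}{n!}A_\lambda = A_1^n. \]
   Context: An Appell sequence is a sequence of polynomials $(A_m)_{m\ge0}$ with $A_0=1$ and $A_m'=mA_{m-1}$ for $m\ge1$. For a partition $\lambda$ of length $r$, let $(n_1,\dots,n_r)=(\lambda_r,\lambda_{r-1}+1,\dots,\lambda_1+r-1)$ and $A_\lambda=\operatorname{Wr}[A_{n_1},\dots,A_{n_r}]/\Delta(n_1,\dots,n_r)$, where $\operatorname{Wr}$ is the Wronskian and $\Delta$ the Vandermonde determinant $\prod_{i<j}(x_j-x_i)$. $F_\lambda$ is the number of standard Young tableaux of shape $\lambda$, and Plancherel measure on partitions of $n$ assigns probability $F_\lambda^2/n!$ to $\lambda\vdash n$. *)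

(* Defs.v *)
From HB Require Import structures.
From mathcomp Require Import all_boot all_order all_algebra.
Set Implicit Arguments. Unset Strict Implicit. Unset Printing Implicit Defensive.
Import Order.TTheory GRing.Theory Num.Theory.
Local Open Scope ring_scope.

(** Partitions of n, encoded as nonincreasing functions 'I_n -> 'I_n.+1
    (parts padded with zeros) whose values sum to n.  Each partition of n
    corresponds to exactly one such function. *)
Definition partvals (n : nat) (f : {ffun 'I_n -> 'I_n.+1}) : seq nat :=
  [seq nat_of_ord (f i) | i <- enum 'I_n].

Definition is_partn (n : nat) (f : {ffun 'I_n -> 'I_n.+1}) : bool :=
  sorted geq (partvals f) && (sumn (partvals f) == n).

Definition partseq (n : nat) (f : {ffun 'I_n -> 'I_n.+1}) : seq nat :=
  [seq k <- partvals f | (0 < k)%N].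

Definition in_shape (l : seq nat) (i j : nat) : bool :=
  (i < size l)%N && (j < nth 0%N l i)%N.

(** Standard Young tableaux of shape l (with n = sumn l cells): fillings of
    the cells by 1..n (value 0 marks cells outside the shape), injective,
    strictly increasing along rows and columns. *)
Definition cell (n : nat) := ('I_n * 'I_n)%type.

Definition is_SYT (l : seq nat) (t : {ffun cell (sumn l) -> 'I_(sumn l).+1}) : bool :=
  [forall c : cell (sumn l), (t c != ord0) == in_shape l c.1 c.2] &&
  [forall c : cell (sumn l), forall d : cell (sumn l),
     (in_shape l c.1 c.2 && in_shape l d.1 d.2 && (c != d)) ==> (t c != t d)] &&
  [forall c : cell (sumn l), forall d : cell (sumn l),
     (in_shape l c.1 c.2 && in_shape l d.1 d.2 && leq c.1 d.1 && leq c.2 d.2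
        && (c != d)) ==> (t c < t d)%N].

Definition nSYT (l : seq nat) : nat := #|[pred t | @is_SYT l t]|.

Definition appell (R : fieldType) (A : nat -> {poly R}) : Prop :=
  A 0%N = 1 /\ forall m : nat, (A m.+1)^`() = (m.+1)%:R *: A m.

Definition Wronskian (R : fieldType) (s : seq {poly R}) : {poly R} :=
  \det (\matrix_(i < size s, j < size s) (nth 0 s j)^`(i)).

Definition vandermonde (R : fieldType) (s : seq nat) : R :=
  \prod_(i < size s) \prod_(j < size s | (i < j)%N)
     ((nth 0%N s j)%:R - (nth 0%N s i)%:R).

Definition shifted (l : seq nat) : seq nat :=
  [seq (nth 0%N l (size l - 1 - i) + i)%N | i <- iota 0 (size l)].

Definition wronskian_appell (R : fieldType) (A : nat -> {poly R}) (l : seq nat)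
  : {poly R} :=
  (vandermonde R (shifted l))^-1 *: Wronskian [seq A k | k <- shifted l].

(* Main.v *)
Require Import Defs.
From HB Require Import structures.
From mathcomp Require Import all_boot all_order all_algebra fingroup perm zify ring.
Set Implicit Arguments. Unset Strict Implicit. Unset Printing Implicit Defensive.
Import GRing.Theory.
Local Open Scope ring_scope.

(** Put [a_m = A_m / m!], so that [a_m' = a_(m-1)]. Then
    [F_lambda A_lambda / n!] is the Jacobi-Trudi determinant
    [s_lambda = det (a_(lambda_j - j + i))], and the claim becomes
    [\sum_lambda F_lambda s_lambda = a_1 ^ n]. Deleting the largest entry of a
    tableau gives [F_lambda = \sum F_(lambda - box)], and
    [\sum s_(lambda + box) = a_1 s_lambda] is a Pieri rule for determinants, so
    the claim follows by induction on [n]. For [a_m = 1 / m!] a similar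
    determinant identity gives [\sum s_(lambda - box) = n s_lambda], whence
    [F_lambda = n! det (1 / (lambda_j - j + i)!)], and this is Frobenius' formula
    [F_lambda = n! Delta / \prod n_i!]. *)

(** * Determinant identities: replaced rows and columns, scaling, reversal *)

Section Determinants.
Variables (K : comNzRingType) (n : nat).
Implicit Types (M N : 'M[K]_n).

Definition replace_col M N (j : 'I_n) : 'M[K]_n :=
  \matrix_(i, j') (if j' == j then N i j' else M i j').

Definition replace_row M N (i : 'I_n) : 'M[K]_n :=
  \matrix_(i', j) (if i' == i then N i' j else M i' j).

(** The cofactors along the replaced column are those of [M]. The sum is Jacobi's derivative of the
    determinant at [M] in the direction [N]. *)
Lemma sum_det_replace_col M N :
  \sum_j \det (replace_col M N j) = \tr (N *m \adj M).
Proof.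
transitivity (\sum_j \sum_i N i j * cofactor M i j).
  apply: eq_bigr => j _; rewrite (expand_det_col _ j); apply: eq_bigr => i _.
  rewrite mxE eqxx; congr (_ * (_ * \det _)); apply/matrixP => i' j'.
  by rewrite !mxE eq_sym (negbTE (neq_lift _ _)).
rewrite exchange_big; apply: eq_bigr => i _; rewrite mxE; apply: eq_bigr => j _.
by rewrite mxE.
Qed.

(** Rows yield the same trace as columns, so a sum over replaced columns can be traded for a sum
    over replaced rows. *)
Lemma sum_det_replace_row M N :
  \sum_i \det (replace_row M N i) = \tr (N *m \adj M).
Proof.
apply: eq_bigr => i _; rewrite (expand_det_row _ i) mxE; apply: eq_bigr => j _.
rewrite mxE eqxx [X in _ = _ * X]mxE; congr (_ * (_ * \det _)).
apply/matrixP => i' j'.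
by rewrite !mxE eq_sym (negbTE (neq_lift _ _)).
Qed.

Lemma det_eq_cols M (j1 j2 : 'I_n) :
  j1 != j2 -> (forall i, M i j1 = M i j2) -> \det M = 0.
Proof.
move=> neq_j eqM; rewrite -det_tr (determinant_alternate neq_j) // => i.
by rewrite !mxE eqM.
Qed.

Lemma det_col_single M (l : 'I_n) :
  (forall i, i != l -> M i l = 0) -> \det M = M l l * cofactor M l l.
Proof.
move=> M0; rewrite (expand_det_col _ l) (bigD1 l) //= big1 ?addr0 //.
by move=> i il; rewrite M0 ?mul0r.
Qed.

Lemma det_scale_cols (d : 'I_n -> K) M :
  \det (\matrix_(i, j) (d j * M i j)) = (\prod_j d j) * \det M.
Proof.
transitivity (\det (M *m diag_mx (\row_j d j))).
  by congr (\det _); rewrite mul_mx_diag; apply/matrixP=> i j; rewrite !mxE mulrC.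
rewrite det_mulmx det_diag mulrC; congr (_ * _).
by apply: eq_bigr => j _; rewrite mxE.
Qed.

(** The same permutation acts on rows and on columns, so its sign occurs twice and cancels. *)
Lemma det_rev M : \det (\matrix_(i, j) M (rev_ord i) (rev_ord j)) = \det M.
Proof.
pose s : 'S_n := perm (@rev_ord_inj n).
have -> : (\matrix_(i, j) M (rev_ord i) (rev_ord j)) = row_perm s (col_perm s M).
  by apply/matrixP => i j; rewrite !mxE !permE.
rewrite row_permE col_permE !det_mulmx !det_perm odd_permV mulrCA.
by rewrite -signr_addb addbb mulr1.
Qed.

End Determinants.

(* Change of basis from the monomials to the [p i] is unitriangular. *)
Lemma det_monic_Vandermonde (K : comNzRingType) n (p : nat -> {poly K})
    (x : 'rV[K]_n) :
    (forall i, p i \is monic) -> (forall i, size (p i) = i.+1) ->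
  \det (\matrix_(i < n, j < n) (p i).[x 0 j]) =
  \prod_(i < n) \prod_(j < n | (i < j)%N) (x 0 j - x 0 i).
Proof.
move=> p_monic size_p.
have -> : \matrix_(i < n, j < n) (p i).[x 0 j] =
    (\matrix_(i < n, k < n) (p i)`_k) *m Vandermonde n x.
  apply/matrixP => i j; rewrite !mxE (@horner_coef_wide _ n); last first.
    by rewrite size_p.
  by apply: eq_bigr => k _; rewrite !mxE.
rewrite det_mulmx det_Vandermonde det_trig; last first.
  by apply/is_trig_mxP => i j ij; rewrite mxE nth_default // size_p.
rewrite big1 ?mul1r // => i _.
by rewrite mxE; have /monicP := p_monic i; rewrite /lead_coef size_p.
Qed.

(** * Jacobi-Trudi determinants and their box-adding and box-removing identities *)

Section JacobiTrudi.
Variables (K : comNzRingType) (a : nat -> K) (n : nat).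

(* [a] extended by zero to the index [m - i], which may be negative *)
Definition coef_sub (m i : nat) : K := if (i <= m)%N then a (m - i)%N else 0.

(** Transpose of the usual matrix [h_(lambda_i - i + j)], with [a] in the role of the complete
    homogeneous functions: parts index columns. *)
Definition jacobi_trudi (f : 'I_n -> nat) : 'M[K]_n :=
  \matrix_(i, j) coef_sub (f j + i) j.

Lemma coef_sub_eq m i m' i' :
  (m + i' = m' + i)%N -> coef_sub m i = coef_sub m' i'.
Proof.
move=> e; rewrite /coef_sub.
have -> : (i <= m)%N = (i' <= m')%N by apply/idP/idP; lia.
by case: ifP => // le_i; congr a; lia.
Qed.

Lemma jacobi_trudi_eq f g :
  f =1 g -> jacobi_trudi f = jacobi_trudi g.
Proof. by move=> fg; apply/matrixP => i j; rewrite !mxE fg. Qed.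

Lemma det_jacobi_trudi0 : a 0 = 1 -> \det (jacobi_trudi (fun=> 0%N)) = 1.
Proof.
move=> a0; rewrite det_trig; last first.
  by apply/is_trig_mxP => i j ij; rewrite mxE /coef_sub add0n leqNgt ij.
by rewrite big1 // => i _; rewrite mxE /coef_sub add0n leqnn subnn a0.
Qed.

Lemma det_jacobi_trudi_eq0 f (j1 j2 : 'I_n) :
  j1 != j2 -> (f j1 + j2 = f j2 + j1)%N -> \det (jacobi_trudi f) = 0.
Proof.
move=> neq_j e; apply: (det_eq_cols neq_j) => i; rewrite !mxE.
by apply: coef_sub_eq; lia.
Qed.

(* Raising a part shifts a column, and shifting every column turns row [i]
   into row [i+1]; so after trading columns for rows only the last row
   contributes. *)
Lemma jacobi_trudi_pieri f (l : 'I_n) : l.+1 = n ->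
    a 0 = 1 -> f l = 0%N ->
  \sum_j \det (jacobi_trudi (fun i => f i + (i == j))%N) =
  a 1 * \det (jacobi_trudi f).
Proof.
move=> ln a0 fl0.
pose N : 'M[K]_n := \matrix_(i, j) coef_sub (f j + i.+1) j.
transitivity (\sum_j \det (replace_col (jacobi_trudi f) N j)).
  apply: eq_bigr => j _; congr (\det _); apply/matrixP => i j'; rewrite !mxE.
  by case: eqVneq => _; rewrite /= ?addn0 // addn1 addSnnS.
rewrite sum_det_replace_col -sum_det_replace_row (bigD1 l) //= big1 ?addr0.
  (* Since the last part is 0 and [a 0 = 1], column [l] is the last unit vector. Both determinants
     thus reduce to the same minor at [(l, l)], with entries [a 1] and 1 there. *)
  have coef_l (i : 'I_n) : coef_sub (f l + i) l = (i == l)%:R.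
    rewrite fl0 add0n /coef_sub -val_eqE /=.
    have lt_in := ltn_ord i.
    by case: ltngtP => [lt_li||->]; [lia | | rewrite subnn a0].
  rewrite (@det_col_single _ _ _ l); last first.
    by move=> i /negbTE il; rewrite !mxE il coef_l il.
  rewrite (@det_col_single _ _ (jacobi_trudi f) l); last first.
    by move=> i /negbTE il; rewrite mxE coef_l il.
  rewrite !mxE eqxx coef_l eqxx mul1r fl0 /coef_sub.
  have -> : (0 + l.+1 - l = 1)%N by lia.
  rewrite ifT; last by lia.
  congr (_ * (_ * \det _)); apply/matrixP => i j.
  by rewrite !mxE eq_sym (negbTE (neq_lift _ _)).
move=> i il.
have lt_iS : (i.+1 < n)%N.
  have := ltn_ord i; move: il; rewrite -val_eqE /=; lia.
apply: (@determinant_alternate _ _ _ i (Ordinal lt_iS)) => [|j].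
  by rewrite -val_eqE /=; lia.
by rewrite !mxE eqxx -val_eqE /= ifN //; lia.
Qed.

(* Here [a m = 1 / m!], so lowering the index by one multiplies the entry
   [(i, j)] by [(f j - j) + i]. *)
Lemma jacobi_trudi_exp f :
    (forall m, m.+1%:R * a m.+1 = a m) ->
  \sum_j \det (replace_col (jacobi_trudi f)
                 (\matrix_(i, j) coef_sub (f j + i) j.+1) j) =
  (\sum_j f j)%:R * \det (jacobi_trudi f).
Proof.
move=> aS; set M := jacobi_trudi f.
pose D : 'rV[K]_n := \row_j ((f j)%:R - j%:R).
pose E : 'rV[K]_n := \row_i i%:R.
have -> : (\matrix_(i, j) coef_sub (f j + i) j.+1) =
    M *m diag_mx D + diag_mx E *m M.
  apply/matrixP => i j; rewrite mul_mx_diag mul_diag_mx !mxE.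
  rewrite [X in _ = _ + X]mulrC -mulrDr addrAC -natrD /coef_sub.
  (* The factor [f j + i - j] vanishes exactly at the border where the lowered index turns
     negative. *)
  case: (ltngtP j (f j + i)) => [lt_j|_|eq_j]; last first.
  - by rewrite -eq_j subrr mulr0.
  - by rewrite mul0r.
  - by rewrite -natrB 1?ltnW // -(subnSK lt_j) mulrC aS.
(* By cyclicity of the trace, [M] meets its adjugate in both summands. What remains is the trace of
   [D] plus that of [E], in which the [j] cancel. *)
rewrite sum_det_replace_col mulmxDl mxtraceD -!mulmxA.
rewrite (mxtrace_mulC M) -mulmxA mul_adj_mx mul_mx_adj.
rewrite !mul_mx_scalar !mxtraceZ -mulrDr mulrC.
rewrite !mxtrace_diag -big_split natr_sum /=; congr (_ * _).
by apply: eq_bigr => j _; rewrite !mxE subrK.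
Qed.

End JacobiTrudi.

(** * Partitions, adding and deleting boxes, and the branching rule for tableaux *)

Section Tableaux.
Variable n : nat.
Local Notation shape := {ffun 'I_n -> 'I_n.+1}.
Local Notation filling := {ffun 'I_n * 'I_n -> 'I_n.+1}.
Implicit Types (f g : shape) (t : filling) (c d : 'I_n * 'I_n) (j : 'I_n).
Local Open Scope nat_scope.

(** The size [k] is separate from the ambient [n], so that induction on [k] stays within one type of
    shapes. *)
Definition is_part k f : bool :=
  [forall i : 'I_n, forall j : 'I_n, (i <= j) ==> (f j <= f i)] &&
  (\sum_i f i == k).

Definition add_box j f : shape := [ffun i => inord (f i + (i == j))].

Definition del_box j f : shape := [ffun i => inord (f i - (i == j))].

Lemma is_partP k f :
  reflect ((forall i j : 'I_n, i <= j -> f j <= f i) /\ \sum_i f i = k)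
          (is_part k f).
Proof.
apply: (iffP andP) => [[/forallP H /eqP ->]|[H ->]]; split=> //.
  by move=> i j ij; move/forallP/(_ j)/implyP: (H i); apply.
by apply/forallP => i; apply/forallP => j; apply/implyP; apply: H.
Qed.

Lemma is_part_le k f i : is_part k f -> f i <= k.
Proof. by case/is_partP => _ <-; rewrite (bigD1 i) //= leq_addr. Qed.

(** A positive last part would make all [n] parts positive, giving a sum of at least [n]. *)
Lemma is_part_last k f (l : 'I_n) :
  l.+1 = n -> k < n -> is_part k f -> f l = 0 :> nat.
Proof.
move=> ln kn /is_partP[mono sum_f]; apply/eqP; rewrite -leqn0 leqNgt.
apply/negP => fl; move: kn; rewrite -sum_f ltnNge => /negP; apply.
rewrite -[X in X <= _]card_ord -sum1_card; apply: leq_sum => i _.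
by apply: leq_trans fl (mono _ _ _); have := ltn_ord i; lia.
Qed.

Lemma add_boxE k j f i :
  k < n -> is_part k f -> add_box j f i = f i + (i == j) :> nat.
Proof.
move=> kn /is_part_le-/(_ i) fi; rewrite ffunE inordK //.
by case: (i == j); lia.
Qed.

Lemma del_boxE j f i : del_box j f i = f i - (i == j) :> nat.
Proof. by rewrite ffunE inordK // ltnS (leq_trans (leq_subr _ _)) // -ltnS. Qed.

Lemma sum_add_box j (F : 'I_n -> nat) :
  \sum_i (F i + (i == j)) = (\sum_i F i).+1.
Proof.
rewrite big_split /= -addn1; congr (_ + _).
by rewrite (bigD1 j) //= eqxx big1 ?addn0 // => i /negbTE ->.
Qed.

Lemma add_boxK k j f : k < n -> is_part k f -> del_box j (add_box j f) = f.
Proof.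
move=> kn pf; apply/ffunP => i; apply/val_inj.
by rewrite /= del_boxE (add_boxE _ _ kn pf) addnK.
Qed.

Lemma del_boxK j f : 0 < f j -> add_box j (del_box j f) = f.
Proof.
move=> fj; apply/ffunP => i; apply/val_inj; rewrite /= ffunE del_boxE.
by rewrite subnK ?inord_val //; case: eqVneq => [->|].
Qed.

Lemma sum_del_box j f : 0 < f j -> (\sum_i del_box j f i).+1 = \sum_i f i.
Proof.
move=> fj; rewrite -(sum_add_box j); apply: eq_bigr => i _.
by rewrite del_boxE subnK //; case: eqVneq => [->|].
Qed.

(** Monotonicity can only break against the row just above, and only at equal lengths. For such [j]
    two Jacobi-Trudi columns coincide, so the term drops out of the Pieri sum. *)
Lemma add_box_notin k j f : k < n -> is_part k f -> ~~ is_part k.+1 (add_box j f) ->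
  exists2 i : 'I_n, i.+1 = j & f i = f j.
Proof.
move=> kn pf np; have [mono sum_f] := is_partP _ _ pf.
have : ~~ [forall i : 'I_n, forall i' : 'I_n,
    (i <= i') ==> (add_box j f i' <= add_box j f i)].
  move: np; rewrite /is_part (eq_bigr (fun i => f i + (i == j))) => [|i _].
    by rewrite sum_add_box sum_f eqxx andbT.
  by rewrite (add_boxE _ _ kn pf).
case/forallPn => i /forallPn[i']; rewrite negb_imply !(add_boxE _ _ kn pf).
case/andP => ii'; rewrite -ltnNge => lt_i.
have le_f := mono _ _ ii'; move: lt_i.
have [e|_] := eqVneq i' j; last by lia.
have [_|ij] := eqVneq i j; [lia | rewrite e in ii' le_f * => lt_i].
have i_lt_j : i < j by rewrite ltn_neqAle ii' andbT -val_eqE in ij *.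
have pj : j.-1 < n by have := ltn_ord j; lia.
(* Rows [i < j] have equal length, and row [j - 1] is squeezed between them. *)
exists (Ordinal pj) => /=; first by lia.
apply/val_inj/eqP; rewrite /= eqn_leq [X in _ && X]mono /= ?leq_pred // andbT.
by apply: leq_trans (mono i _ _) _ => /=; lia.
Qed.

Lemma del_box_notin k j f : is_part k.+1 f -> 0 < f j -> ~~ is_part k (del_box j f) ->
  exists2 i : 'I_n, i = j.+1 :> nat & f i = f j.
Proof.
move=> pf fj np; have [mono sum_f] := is_partP _ _ pf.
have : ~~ [forall i : 'I_n, forall i' : 'I_n,
    (i <= i') ==> (del_box j f i' <= del_box j f i)].
  move: np; rewrite /is_part -eqSS sum_del_box //.
  by rewrite sum_f eqxx andbT.
case/forallPn => i /forallPn[i']; rewrite negb_imply !del_boxE.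
case/andP => ii'; rewrite -ltnNge => lt_i.
have le_f := mono _ _ ii'; move: lt_i.
have [e|_] := eqVneq i j; last by lia.
have [_|ij] := eqVneq i' j; [lia | rewrite e in ii' le_f * => lt_i].
have i_lt_j : j < i' by rewrite ltn_neqAle ii' andbT eq_sym -val_eqE in ij *.
have pj : j.+1 < n by have := ltn_ord i'; lia.
exists (Ordinal pj) => //=.
apply/val_inj/eqP; rewrite /= eqn_leq mono //=.
by apply: (@leq_trans (f i')); [lia | apply: mono].
Qed.

(** For each fixed row [j], [add_box j] and [del_box j] are inverse bijections between the two index
    sets; [k < n] keeps [inord] in range. *)
Lemma exchange_box (V : nmodType) (F : shape -> shape -> V) k : k < n ->
  (\sum_(f | is_part k.+1 f)
     \sum_(j | (0 < f j)%N && is_part k (del_box j f)) F f (del_box j f) =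
   \sum_(g | is_part k g)
     \sum_(j | is_part k.+1 (add_box j g)) F (add_box j g) g)%R.
Proof.
move=> kn.
rewrite (exchange_big_dep xpredT) //= [RHS](exchange_big_dep xpredT) //=.
apply: eq_bigr => j _.
rewrite (reindex_onto (add_box j) (del_box j)) => [|f /andP[_ /andP[fj _]]]; last first.
  exact: del_boxK.
have add_gt0 g : is_part k g -> 0 < add_box j g j.
  by move=> pg; rewrite (add_boxE _ _ kn pg) eqxx addn1.
apply: eq_big => [g|g]; last by case/andP => _ /eqP ->.
apply/idP/idP => [/andP[/and3P[-> _]] pg /eqP <- //|/andP[pg ->]]; first by rewrite pg.
by rewrite add_gt0 // (add_boxK _ kn pg) pg eqxx.
Qed.

(** All fillings live on one [n] by [n] board, and the last clause bounds entries by [k], so erasing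
    the largest entry does not change the type. *)
Definition is_tableau k f t : bool :=
  [&& [forall c : 'I_n * 'I_n, (t c != ord0) == (c.2 < f c.1)],
      [forall c : 'I_n * 'I_n, forall d : 'I_n * 'I_n,
         (c.2 < f c.1) && (d.2 < f d.1) && (c != d) ==> (t c != t d)],
      [forall c : 'I_n * 'I_n, forall d : 'I_n * 'I_n,
         (c.2 < f c.1) && (d.2 < f d.1) && (c.1 <= d.1) && (c.2 <= d.2) && (c != d) ==> (t c < t d)]
    & [forall c : 'I_n * 'I_n, t c <= k]].

Definition num_tableaux k f : nat := #|[pred t | is_tableau k f t]|.

Lemma is_tableauP k f t :
  reflect [/\ forall c, (0 < t c) = (c.2 < f c.1),
              forall c d, c.2 < f c.1 -> d.2 < f d.1 -> t c = t d :> nat -> c = d,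
              forall c d, c.2 < f c.1 -> d.2 < f d.1 -> c.1 <= d.1 -> c.2 <= d.2 ->
                 c != d -> t c < t d
            & forall c, t c <= k]
          (is_tableau k f t).
Proof.
apply: (iffP and4P) => [[H1 H2 H3 H4]|[H1 H2 H3 H4]]; split.
- by move=> c; rewrite lt0n; exact: (eqP (forallP H1 c)).
- move=> c d hc hd /val_inj e; apply/eqP; apply: contraTT (eqxx (t c)) => cd.
  by move/forallP/(_ d)/implyP: (forallP H2 c); rewrite hc hd cd {3}e; apply.
- move=> c d hc hd h1 h2 cd.
  by move/forallP/(_ d)/implyP: (forallP H3 c); rewrite hc hd h1 h2 cd; apply.
- exact/forallP.
- by apply/forallP => c; rewrite -H1 lt0n; apply/eqP.
- apply/forallP => c; apply/forallP => d; apply/implyP => /andP[/andP[hc hd]].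
  by apply: contra => /eqP e; apply/eqP/H2 => //; rewrite e.
- apply/forallP => c; apply/forallP => d; apply/implyP.
  by case/andP => /andP[/andP[/andP[hc hd] h1] h2] h3; apply: H3.
- exact/forallP.
Qed.

Lemma card_shape k f :
  is_part k f -> #|[set c : 'I_n * 'I_n | c.2 < f c.1]| = k.
Proof.
case/is_partP => _ <-; rewrite -sum1_card.
rewrite (eq_bigl (fun c => xpredT c.1 && (c.2 < f c.1))) => [|c]; last by rewrite inE.
rewrite -(pair_big_dep xpredT (fun i (j : 'I_n) => j < f i) (fun _ _ => 1)) /=.
apply: eq_bigr => i _; have fi : f i <= n by rewrite -ltnS.
by rewrite (big_ord_narrow fi) sum1_card card_ord.
Qed.

(** Pigeonhole: otherwise [k + 1] cells would receive distinct values among [1..k]. *)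
Lemma tableau_max k f t : is_part k.+1 f -> is_tableau k.+1 f t ->
  exists c, t c = k.+1 :> nat.
Proof.
move=> pf /is_tableauP[t0 t_inj _ t_le].
case: (pickP (fun c => t c == k.+1 :> nat)) => [c /eqP tc|no_max]; first by exists c.
suff : #|[set c : 'I_n * 'I_n | c.2 < f c.1]| <= k.
  by rewrite (card_shape pf) ltnn.
rewrite -[X in _ <= X]card_ord; case: k => [|k] in pf t_le no_max *.
  have /card_gt0P[c] : 0 < #|[set c : 'I_n * 'I_n | c.2 < f c.1]|.
    by rewrite (card_shape pf).
  by rewrite inE -t0 => tc; have := no_max c; have := t_le c; lia.
apply: (leq_card_in (fun c => inord (t c).-1 : 'I_k.+1)) => c d.
rewrite !inE => sc sd /(congr1 val) /=.
have bound e : (t e).-1 < k.+1 by have := no_max e; have := t_le e; lia.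
rewrite !inordK // => e; apply: t_inj => //.
by move: sc sd; rewrite -!t0; lia.
Qed.

(** A further cell weakly below and right of [c] would need an entry above the maximum. Hence [c]
    ends its row and the next row is shorter. *)
Lemma tableau_corner k f t c : is_part k.+1 f -> is_tableau k.+1 f t ->
  t c = k.+1 :> nat -> f c.1 = c.2.+1 :> nat /\ is_part k (del_box c.1 f).
Proof.
move=> pf /is_tableauP[t0 t_inj t_mono t_le] tc.
have sc : c.2 < f c.1 by rewrite -t0 tc.
have max_c d : c.1 <= d.1 -> c.2 <= d.2 -> d.2 < f d.1 -> c = d.
  move=> h1 h2 sd; apply/eqP; apply: contraLR (t_le d) => cd.
  by rewrite -ltnNge -tc; apply: t_mono.
split.
  apply/eqP; rewrite eqn_leq sc andbT leqNgt; apply/negP => lt_c.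
  have c2 : c.2.+1 < n by apply: leq_trans lt_c _; rewrite -ltnS.
  have := max_c (c.1, Ordinal c2) (leqnn _) (leqnSn _) lt_c.
  by move/(congr1 (fun d => val d.2)) => /=; lia.
apply: contraT => /(del_box_notin pf (leq_ltn_trans (leq0n _) sc))[i ic fi].
have := max_c (i, c.2); rewrite /= ic leqnSn leqnn fi sc => /(_ isT isT isT).
by move/(congr1 (fun d => val d.1)) => /=; lia.
Qed.

(** Writing [k + 1] into the last cell of row [j] ([ins]) and erasing it ([del]) are mutually
    inverse. *)
Lemma card_tableaux_corner k f j : k < n -> is_part k.+1 f ->
    0 < f j -> is_part k (del_box j f) ->
  \sum_(t | is_tableau k.+1 f t &&
            [exists c : 'I_n * 'I_n, (c.1 == j) && (t c == k.+1 :> nat)]) 1 =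
  num_tableaux k (del_box j f).
Proof.
move=> kn pf fj pg; set g := del_box j f.
have gE i : g i = f i - (i == j) :> nat := del_boxE j f i.
have gj : g j < n by have := ltn_ord (f j); rewrite gE eqxx; lia.
(* Columns count from 0, so the last cell of row [j] of [f] lies in column [f j - 1 = g j]. *)
pose c0 : 'I_n * 'I_n := (j, Ordinal gj).
have shapeE c : (c.2 < f c.1) = (c == c0) || (c.2 < g c.1).
  rewrite gE; case: c => c1 c2; rewrite /c0 xpair_eqE -[c2 == _]val_eqE /= gE eqxx.
  by case: (eqVneq c1 j) => [->|_] /=; lia.
have c0_notin : (c0.2 < g c0.1) = false by rewrite ltnn.
pose ins t : filling := [ffun c => if c == c0 then inord k.+1 else t c].
pose del t : filling := [ffun c => if c == c0 then ord0 else t c].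
have k1 : k.+1 < n.+1 by [].
have max_c0 t c : is_tableau k.+1 f t -> c.1 = j -> t c = k.+1 :> nat -> c = c0.
  move=> ht cj tc; have [fc _] := tableau_corner pf ht tc.
  rewrite [c]surjective_pairing cj; congr pair; apply/val_inj => /=.
  by rewrite gE eqxx -cj fc subn1.
rewrite (reindex_onto ins del) => [|t]; last first.
  case/andP => ht /existsP[c /andP[/eqP cj /eqP tc]].
  have ec := max_c0 _ _ ht cj tc; apply/ffunP => d; rewrite !ffunE.
  case: eqVneq => [->|//]; apply/val_inj.
  by rewrite /= -ec tc inordK.
rewrite sum1_card /num_tableaux; apply: eq_card => t; rewrite !inE.
apply/andP/idP => [[/andP[/is_tableauP[t0 t_inj t_mono t_le] _] /eqP delK]|].
  have tc0 : t c0 = ord0 by rewrite -delK ffunE eqxx.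
  have insE c : c != c0 -> ins t c = t c by move/negbTE=> cc0; rewrite ffunE cc0.
  have ins_c0 : ins t c0 = k.+1 :> nat by rewrite ffunE eqxx inordK.
  have in_g c : c.2 < g c.1 -> c != c0 /\ c.2 < f c.1.
    move=> sc; rewrite shapeE sc orbT; split=> //.
    by apply: contraTneq sc => ->; rewrite c0_notin.
  apply/is_tableauP; split.
  - move=> c; have [->|cc0] := eqVneq c c0; first by rewrite tc0 c0_notin.
    by rewrite -insE // t0 shapeE (negbTE cc0).
  - move=> c d /in_g[cc0 sc] /in_g[dc0 sd] e.
    by apply: t_inj => //; rewrite !insE.
  - move=> c d /in_g[cc0 sc] /in_g[dc0 sd] h1 h2 cd.
    by rewrite -!insE //; apply: t_mono.
  - move=> c; have [->|cc0] := eqVneq c c0; first by rewrite tc0.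
    rewrite -ltnS ltn_neqAle -insE // t_le andbT; apply/eqP => e.
    suff /eqP : c = c0 by rewrite (negbTE cc0).
    apply: t_inj; [|by rewrite shapeE eqxx|by rewrite ins_c0].
    by rewrite -t0 e.
move=> /is_tableauP[t0 t_inj t_mono t_le].
have tc0 : t c0 = ord0 by apply/val_inj/eqP; rewrite -leqn0 leqNgt t0 c0_notin.
have insE c : c != c0 -> ins t c = t c by move/negbTE=> cc0; rewrite ffunE cc0.
have ins_c0 : ins t c0 = k.+1 :> nat by rewrite ffunE eqxx inordK.
have in_f c : c != c0 -> c.2 < f c.1 -> c.2 < g c.1.
  by move=> /negbTE cc0; rewrite shapeE cc0.
split; last first.
  by apply/eqP/ffunP => c; rewrite !ffunE; case: eqVneq => [->|].
apply/andP; split; last by apply/existsP; exists c0; rewrite ins_c0 !eqxx.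
have [mono_g _] := is_partP _ _ pg.
apply/is_tableauP; split.
- move=> c; have [->|cc0] := eqVneq c c0; first by rewrite ins_c0 shapeE eqxx.
  by rewrite insE // t0 shapeE (negbTE cc0).
- move=> c d sc sd.
  have [->|cc0] := eqVneq c c0; have [->|dc0] := eqVneq d c0 => //;
    rewrite ?ins_c0 ?insE // => e.
  + by have := t_le d; rewrite -e ltnn.
  + by have := t_le c; rewrite e ltnn.
  + by apply: t_inj => //; apply: in_f.
- move=> c d sc sd h1 h2 cd.
  have [ec|cc0] := eqVneq c c0.
    (* no cell of the smaller shape lies weakly below and right of [c0] *)
    have dc0 : d != c0 by rewrite -ec eq_sym.
    have := in_f d dc0 sd; rewrite ec /= in h1 h2.
    by rewrite ltnNge (leq_trans (mono_g _ _ h1)).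
  have [ed|dc0] := eqVneq d c0.
    by rewrite ed ins_c0 insE // ltnS.
  by rewrite !insE //; apply: t_mono => //; apply: in_f.
- move=> c; have [->|cc0] := eqVneq c c0; first by rewrite ins_c0.
  by rewrite insE // ltnW // ltnS.
Qed.

Lemma num_tableaux_branching k f : k < n -> is_part k.+1 f ->
  num_tableaux k.+1 f =
  \sum_(j | (0 < f j) && is_part k (del_box j f)) num_tableaux k (del_box j f).
Proof.
move=> kn pf.
transitivity (\sum_(j | (0 < f j) && is_part k (del_box j f))
   \sum_(t | is_tableau k.+1 f t &&
            [exists c : 'I_n * 'I_n, (c.1 == j) && (t c == k.+1 :> nat)]) 1);
  last by apply: eq_bigr => j /andP[fj pj]; apply: card_tableaux_corner.
(* After the swap each tableau is counted once: its largest entry lies in exactly one cell, which is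
   a removable corner. *)
rewrite (exchange_big_dep (is_tableau k.+1 f)) /=; last by move=> i t _ /andP[].
rewrite /num_tableaux -sum1_card; apply: eq_bigr => t; rewrite inE => ht.
have [c tc] := tableau_max pf ht.
have [fc pc] := tableau_corner pf ht tc.
rewrite (big_pred1 c.1) // => j /=; rewrite ht /=; apply/idP/eqP => [|->].
  case/andP => _ /existsP[d /andP[/eqP <- /eqP td]]; congr (_.1).
  have /is_tableauP[t0 t_inj _ _] := ht.
  by apply: t_inj; rewrite -?t0 ?td ?tc.
by rewrite fc pc; apply/existsP; exists c; rewrite tc !eqxx.
Qed.

Lemma num_tableaux0 f : is_part 0 f -> num_tableaux 0 f = 1.
Proof.
move=> pf; have f0 i : f i = 0 :> nat.
  by apply/eqP; rewrite -leqn0 (is_part_le _ pf).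
rewrite /num_tableaux (eq_card (B := pred1 [ffun=> ord0])) ?card1 // => t.
rewrite !inE; apply/is_tableauP/eqP => [[_ _ _ t0]|->].
  by apply/ffunP => c; apply/val_inj/eqP; rewrite ffunE -leqn0 t0.
by split=> [c|c d|c d|c]; rewrite ?ffunE ?f0.
Qed.

End Tableaux.

(** * Sums of Jacobi-Trudi determinants over partitions *)

Section SchurSums.
Variables (K : comNzRingType) (a : nat -> K) (n : nat).
Local Notation shape := {ffun 'I_n -> 'I_n.+1}.
Local Notation schur f := (\det (jacobi_trudi a (fun i => nat_of_ord (f i)))).
Hypothesis a0 : a 0 = 1.

Lemma schur0 (f : shape) : is_part 0 f -> schur f = 1.
Proof.
move=> pf; rewrite -(det_jacobi_trudi0 n a0); congr (\det _).
apply: jacobi_trudi_eq => i; apply/eqP; rewrite -leqn0; exact: is_part_le pf.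
Qed.

(** [k < n] leaves the last row empty, as the Pieri rule requires; positions where no box fits
    contribute determinants with two equal columns. *)
Lemma schur_add k (f : shape) : (k < n)%N -> is_part k f ->
  \sum_(j | is_part k.+1 (add_box j f)) schur (add_box j f) = a 1 * schur f.
Proof.
move=> kn pf; have ln : (n.-1 < n)%N by lia.
rewrite -(@jacobi_trudi_pieri _ _ _ _ (Ordinal ln)) //=; [|lia|]; last first.
  by apply: (is_part_last _ kn pf) => /=; lia.
rewrite [RHS](bigID (fun j => is_part k.+1 (add_box j f))) /=.
rewrite [X in _ = _ + X]big1 ?addr0.
  apply: eq_bigr => j _; congr (\det _); apply: jacobi_trudi_eq => i.
  exact: add_boxE kn pf.
move=> j /(add_box_notin kn pf)[i ij fij].
have neq_ij : (i == j) = false by rewrite -val_eqE /=; lia.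
apply: (@det_jacobi_trudi_eq0 _ _ _ _ i j); first by rewrite neq_ij.
by rewrite neq_ij eqxx fij; lia.
Qed.

Lemma sum_num_tableaux_schur k : (k <= n)%N ->
  \sum_(f : shape | is_part k f) (num_tableaux k f)%:R * schur f = a 1 ^+ k.
Proof.
elim: k => [_|k IHk kn].
  have p0 : is_part 0 ([ffun=> ord0] : shape).
    by apply/is_partP; split=> [i j|]; rewrite ?big1 // => *; rewrite !ffunE.
  rewrite (big_pred1 [ffun=> ord0]) => [|f].
    by rewrite num_tableaux0 // schur0 // mulr1.
  apply/idP/eqP => [pf|-> //]; apply/ffunP => i; apply/val_inj/eqP.
  by rewrite ffunE /= -leqn0 (is_part_le _ pf).
rewrite exprS -IHk 1?ltnW // mulr_sumr.
under eq_bigr => f pf do rewrite (num_tableaux_branching kn pf) natr_sum mulr_suml.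
(* Regrouping the pairs by the smaller shape [g] turns the inner sum into a Pieri sum. *)
rewrite (exchange_box (fun f g => (num_tableaux k g)%:R * schur f) kn).
apply: eq_bigr => g pg; rewrite -mulr_sumr (schur_add kn pg).
by rewrite mulrCA.
Qed.

Hypothesis aS : forall m, m.+1%:R * a m.+1 = a m.

Lemma schur_del k (f : shape) : is_part k.+1 f ->
  \sum_(j | (0 < f j)%N && is_part k (del_box j f)) schur (del_box j f) =
  k.+1%:R * schur f.
Proof.
move=> pf; have [mono sum_f] := is_partP _ _ pf.
rewrite -sum_f -jacobi_trudi_exp //.
pose P j := (0 < f j)%N && is_part k (del_box j f).
rewrite [RHS](bigID P) /= [X in _ = _ + X]big1 ?addr0.
  apply: eq_bigr => j /andP[fj _]; congr (\det _); apply/matrixP => i j'.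
  rewrite !mxE del_boxE; case: eqVneq => [->|_]; last by rewrite subn0.
  by apply: coef_sub_eq; lia.
move=> j not_corner.
have repeated (i : 'I_n) : i = j.+1 :> nat -> f i = f j ->
    \det (replace_col (jacobi_trudi a (fun i => f i))
            (\matrix_(i, j) coef_sub a (f j + i) j.+1) j) = 0.
  move=> ij fij; have neq_ij : (i == j) = false by rewrite -val_eqE /=; lia.
  apply: (@det_eq_cols _ _ _ i j); first by rewrite neq_ij.
  by move=> i'; rewrite !mxE neq_ij eqxx fij ij.
move: not_corner; rewrite /P; case: posnP => [fj0 _|fj /= np].
  (* An empty row above another row repeats the next column once lowered. In the last row the
     lowered column is zero, its indices [i - n] being negative. *)
  have [jn|nj] := ltnP j.+1 n.
    apply: (repeated (Ordinal jn)) => //; apply/val_inj/eqP => /=.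
    by rewrite fj0 -leqn0 -fj0 mono /=.
  rewrite (expand_det_col _ j) big1 // => i _; rewrite !mxE eqxx fj0.
  by rewrite /coef_sub ifN ?mul0r // -ltnNge; have := ltn_ord i; lia.
by have [i ij fij] := del_box_notin pf fj np; apply: (repeated i).
Qed.

Lemma num_tableaux_schur k (f : shape) : (k <= n)%N -> is_part k f ->
  (num_tableaux k f)%:R = k`!%:R * schur f.
Proof.
elim: k f => [|k IHk] f kn pf; first by rewrite num_tableaux0 // schur0 // mulr1.
rewrite (num_tableaux_branching kn pf) natr_sum factS mulnC natrM -mulrA.
rewrite -(schur_del pf) mulr_sumr; apply: eq_bigr => j /andP[_ pj].
by rewrite IHk // ltnW.
Qed.

End SchurSums.

(** * Agreement with the encoding of partitions and tableaux by lists *)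

Section PartSeq.
Variable n : nat.
Implicit Types f : {ffun 'I_n -> 'I_n.+1}.
Local Open Scope nat_scope.

Lemma size_partvals f : size (partvals f) = n.
Proof. by rewrite size_map size_enum_ord. Qed.

Lemma nth_partvals f (i : 'I_n) : nth 0 (partvals f) i = f i.
Proof.
rewrite (nth_map i) ?size_enum_ord //; congr (nat_of_ord (f _)).
exact: nth_ord_enum.
Qed.

Lemma is_partnE f : is_partn f = is_part n f.
Proof.
rewrite /is_partn /is_part sumnE big_map big_enum /=; congr andb.
apply/idP/forallP => [s_f i|mono].
  apply/forallP => j; apply/implyP => ij; rewrite -!nth_partvals.
  have := @sorted_leq_nth _ geq _ _ 0 _ s_f i j; apply => //.
  - by move=> x y z /= h1 h2; apply: leq_trans h2 h1.
  - exact: leqnn.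
  - by rewrite inE size_partvals.
  - by rewrite inE size_partvals.
apply/(sortedP 0) => i; rewrite size_partvals => iS.
have := mono (Ordinal (ltnW iS)) => /forallP/(_ (Ordinal iS))/implyP.
by rewrite -!nth_partvals /=; apply.
Qed.

(** In a nonincreasing list the zeros come last, so filtering them out only cuts a tail. *)
Lemma sorted_geq_pos (s : seq nat) : sorted geq s ->
  s = [seq k <- s | 0 < k] ++ nseq (size s - size [seq k <- s | 0 < k]) 0.
Proof.
elim: s => //= x s IHs; case: posnP => [-> {x}|x0] s_xs.
  have {s_xs IHs} : all (pred1 0) s.
    elim: s s_xs {IHs} => //= y s IHs /andP[]; rewrite leqn0 => /eqP ->.
    by move=> ps; rewrite IHs.
  move=> s0; rewrite (@eq_in_filter _ _ pred0) => [|x /(allP s0)/eqP -> //].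
  by rewrite filter_pred0 /=; move/all_pred1P: s0 => {1}->.
by rewrite /= subSS -IHs // (path_sorted s_xs).
Qed.

Lemma in_shape_partseq f (i j : 'I_n) :
  is_partn f -> in_shape (partseq f) i j = (j < f i).
Proof.
case/andP => s_f _; rewrite -nth_partvals (sorted_geq_pos s_f) nth_cat nth_nseq.
rewrite /in_shape -/(partseq f); case: ltnP => //= _.
by rewrite if_same.
Qed.

Lemma sumn_partseq f : is_partn f -> sumn (partseq f) = n.
Proof.
case/andP => s_f /eqP sum_f; rewrite -[RHS]sum_f [in RHS](sorted_geq_pos s_f).
by rewrite sumn_cat sumn_nseq mul0n addn0.
Qed.

(** The board size [sumn l] occurs in the type of fillings. Freeing it as [m] lets it be replaced by
    [n] without casts. *)
Lemma nSYT_cast (l : seq nat) m : sumn l = m ->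
  nSYT l = #|[pred t : {ffun 'I_m * 'I_m -> 'I_m.+1} |
    [forall c : 'I_m * 'I_m, (t c != ord0) == in_shape l c.1 c.2] &&
    [forall c : 'I_m * 'I_m, forall d : 'I_m * 'I_m,
       (in_shape l c.1 c.2 && in_shape l d.1 d.2 && (c != d)) ==> (t c != t d)] &&
    [forall c : 'I_m * 'I_m, forall d : 'I_m * 'I_m,
       (in_shape l c.1 c.2 && in_shape l d.1 d.2 && leq c.1 d.1 && leq c.2 d.2
         && (c != d)) ==> (t c < t d)]]|.
Proof. by move=> <-. Qed.

Lemma nSYT_partseq f : is_partn f -> nSYT (partseq f) = num_tableaux n f.
Proof.
move=> pf; rewrite (nSYT_cast (sumn_partseq pf)); apply: eq_card => t.
rewrite !inE /is_tableau -andbA; congr [&& _, _ & _].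
- by apply: eq_forallb => c; rewrite in_shape_partseq.
- by apply: eq_forallb => c; apply: eq_forallb => d; rewrite !in_shape_partseq.
(* For [k = n] the bound on entries already follows from their type. *)
have -> : [forall c, t c <= n] by apply/forallP => c; rewrite -ltnS.
rewrite andbT.
by apply: eq_forallb => c; apply: eq_forallb => d; rewrite !in_shape_partseq.
Qed.

End PartSeq.

(** * The shifted exponents [n_i] and zero padding *)

Section Shifted.
Local Open Scope nat_scope.

Lemma size_shifted l : size (shifted l) = size l.
Proof. by rewrite size_map size_iota. Qed.

Lemma nth_shifted l i : i < size l ->
  nth 0 (shifted l) i = nth 0 l (size l - 1 - i) + i.
Proof. by move=> li; rewrite (nth_map 0) ?size_iota // nth_iota. Qed.

Lemma shifted_rcons0 l : shifted (rcons l 0) = 0 :: map S (shifted l).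
Proof.
rewrite /shifted size_rcons /= subn1 /= subn0 nth_rcons ltnn eqxx; congr cons.
rewrite -[1]addn0 iotaDl -!map_comp; apply/eq_in_map => i.
rewrite mem_iota /= => li; rewrite add1n addnS nth_rcons ifT; last by lia.
by congr (nth _ _ _ + _).+1; lia.
Qed.

End Shifted.

(** [shifted] starts from the smallest part, so the two matrices match after reversing rows and
    columns: [n_j - i] becomes part minus column plus row. *)
Lemma det_coef_sub_shifted (K : comNzRingType) (c : nat -> K) n
    (f : {ffun 'I_n -> 'I_n.+1}) :
  \det (\matrix_(i < n, j < n) coef_sub c (nth 0%N (shifted (partvals f)) j) i) =
  \det (jacobi_trudi c (fun i => f i)).
Proof.
rewrite -(det_rev (jacobi_trudi _ _)); congr (\det _); apply/matrixP => i j.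
rewrite !mxE nth_shifted size_partvals // -subnDA add1n.
rewrite (nth_partvals f (rev_ord j)); apply: coef_sub_eq => /=.
by have := ltn_ord i; have := ltn_ord j; lia.
Qed.

(** * Wronskian Appell polynomials as quotients of Jacobi-Trudi determinants *)

Section Appell.
Variables (R : fieldType) (A : nat -> {poly R}).
Hypothesis pcharR : [pchar R] =i pred0.
Hypothesis appA : appell A.

Let natR_neq0 m : (0 < m)%N -> m%:R != 0 :> R.
Proof. by rewrite lt0n (pcharf0P R).1. Qed.

Lemma Wronskian_size (s : seq {poly R}) m : size s = m ->
  Wronskian s = \det (\matrix_(i < m, j < m) (nth 0 s j)^`(i)).
Proof. by move=> <-. Qed.

Lemma vandermonde_size s m : size s = m ->
  vandermonde R s =
  \prod_(i < m) \prod_(j < m | (i < j)%N) ((nth 0%N s j)%:R - (nth 0%N s i)%:R).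
Proof. by move=> <-. Qed.

(** Differences with the new entry 0 give the product; the common shift by one preserves all
    others. *)
Lemma vandermonde_cons0 s :
  vandermonde R (0%N :: map S s) = (\prod_(m <- s) m.+1%:R) * vandermonde R s.
Proof.
rewrite /vandermonde /= size_map big_ord_recl; congr (_ * _).
  rewrite big_mkcond big_ord_recl /= mul1r (big_nth 0%N) big_mkord.
  by apply: eq_bigr => i _; rewrite subr0 add0n (nth_map 0%N).
apply: eq_bigr => i _; rewrite big_mkcond big_ord_recl /= mul1r [RHS]big_mkcond.
apply: eq_bigr => j _; rewrite !add0n !(nth_map 0%N) //.
by rewrite -!natr1 opprD addrACA subrr addr0.
Qed.

(** As [A 0 = 1], the first column is a unit vector. The remaining minor starts at first
    derivatives, and [A_(m+1)' = (m+1) A_m] pulls one scalar out of each column. *)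
Lemma Wronskian_cons0 s :
  Wronskian [seq A m | m <- 0%N :: map S s] =
  (\prod_(m <- s) m.+1%:R) *: Wronskian [seq A m | m <- s].
Proof.
have [A0 AS] := appA.
rewrite (@Wronskian_size _ (size s).+1) ?size_map /= ?size_map //.
rewrite (@Wronskian_size _ (size s)) ?size_map //.
rewrite (@det_col_single _ _ _ ord0) => [|i i0]; last first.
  rewrite mxE /= A0; case: i i0 => [[|i] hi] // _.
  by rewrite derivSn derivC linear0.
rewrite mxE /= A0 mul1r /cofactor addn0 expr0 mul1r.
rewrite -mul_polyC (big_nth 0%N) big_mkord rmorph_prod -det_scale_cols.
congr (\det _); apply/matrixP => i j; rewrite !mxE !lift0 /=.
by rewrite !(nth_map 0%N) ?size_map // -derivnS derivSn AS derivnZ -mul_polyC.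
Qed.

(** Padding multiplies Wronskian and Vandermonde by the same product, nonzero in characteristic 0.
    This permits [n] parts for every partition of [n]. *)
Lemma wronskian_appell_rcons0 l :
  wronskian_appell A (rcons l 0%N) = wronskian_appell A l.
Proof.
rewrite /wronskian_appell shifted_rcons0 vandermonde_cons0 Wronskian_cons0.
rewrite scalerA invfM mulrAC mulVf ?mul1r //.
by rewrite prodf_seq_neq0; apply/allP => m _; apply: natR_neq0.
Qed.

Lemma wronskian_appell_partseq n (f : {ffun 'I_n -> 'I_n.+1}) :
  is_partn f -> wronskian_appell A (partseq f) = wronskian_appell A (partvals f).
Proof.
case/andP => s_f _; rewrite [in RHS](sorted_geq_pos s_f) -/(partseq f).
elim: (_ - _)%N => [|z IHz]; first by rewrite cats0.
by rewrite -addn1 nseqD catA cats1 wronskian_appell_rcons0.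
Qed.

Let a m : {poly R} := (m`!%:R)^-1 *: A m.
Let b m : R := (m`!%:R)^-1.

Let a0 : a 0 = 1.
Proof. by case: appA => A0 _; rewrite /a A0 invr1 scale1r. Qed.

Let b0 : b 0 = 1.
Proof. exact: invr1. Qed.

Let bS m : m.+1%:R * b m.+1 = b m.
Proof. by rewrite /b factS natrM invfM mulVKf // natR_neq0. Qed.

Lemma appell_derivn m i : (A m)^`(i) = m`!%:R *: coef_sub a m i.
Proof.
have [A0 AS] := appA.
elim: i => [|i IHi].
  by rewrite /coef_sub /= subn0 scalerA divff ?scale1r // natR_neq0 ?fact_gt0.
rewrite derivnS IHi derivZ; congr (_ *: _); rewrite /coef_sub.
case: ltngtP => [lt_im||->]; rewrite ?linear0 //; last first.
  by rewrite subnn a0 derivC.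
rewrite -(subnSK lt_im) /a derivZ AS scalerA mulrC.
by congr (_ *: _); apply: bS.
Qed.

(** This is the falling factorial [m! / (m - i)!]; for [i > m] the factor at [k = m] vanishes. *)
Lemma prod_XsubC_nat m i :
  (\prod_(k < i) ('X - k%:R%:P)).[m%:R] = m`!%:R * coef_sub b m i :> R.
Proof.
rewrite horner_prod; elim: i => [|i IHi].
  by rewrite big_ord0 /coef_sub subn0 divff // natR_neq0 ?fact_gt0.
rewrite big_ord_recr /= IHi hornerXsubC -mulrA; congr (_ * _).
rewrite /coef_sub; case: ltngtP => [lt_im|_|->]; last by rewrite subrr mulr0.
  by rewrite -natrB 1?ltnW // -(subnSK lt_im) mulrC bS.
by rewrite mul0r.
Qed.

(** Falling factorials replace the powers [n_j ^ i] without changing the determinant, and each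
    column then releases [n_j!]. *)
Lemma vandermonde_partvals n (f : {ffun 'I_n -> 'I_n.+1}) :
  vandermonde R (shifted (partvals f)) =
  (\prod_(j < n) (nth 0%N (shifted (partvals f)) j)`!%:R) *
  \det (jacobi_trudi b (fun i => f i)).
Proof.
rewrite -det_coef_sub_shifted; set s := shifted _.
have size_s : size s = n by rewrite size_shifted size_partvals.
rewrite (vandermonde_size size_s).
pose x : 'rV[R]_n := \row_j (nth 0%N s j)%:R.
pose p i : {poly R} := \prod_(k < i) ('X - k%:R%:P).
rewrite -det_scale_cols.
transitivity (\det (\matrix_(i < n, j < n) (p i).[x 0 j])).
  rewrite det_monic_Vandermonde => [|i|i].
  - by apply: eq_bigr => i _; apply: eq_bigr => j _; rewrite !mxE.
  - exact: monic_prod_XsubC.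
  - by rewrite size_prod_XsubC /index_enum -enumT size_enum_ord.
by congr (\det _); apply/matrixP => i j; rewrite !mxE prod_XsubC_nat.
Qed.

Lemma Wronskian_partvals n (f : {ffun 'I_n -> 'I_n.+1}) :
  Wronskian [seq A m | m <- shifted (partvals f)] =
  (\prod_(j < n) (nth 0%N (shifted (partvals f)) j)`!%:R) *:
  \det (jacobi_trudi a (fun i => f i)).
Proof.
rewrite -det_coef_sub_shifted; set s := shifted _.
have size_s : size s = n by rewrite size_shifted size_partvals.
rewrite (@Wronskian_size _ n) ?(size_map A) // -mul_polyC rmorph_prod -det_scale_cols.
congr (\det _); apply/matrixP => i j; rewrite !mxE (nth_map 0%N) ?size_s //.
by rewrite appell_derivn -mul_polyC.
Qed.

(** With [F = n! D], Vandermonde [P D] and Wronskian [P S], the term is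
    [F ^ 2 / n! * S / D = F S]. *)
Lemma plancherel_term n (f : {ffun 'I_n -> 'I_n.+1}) : is_partn f ->
  (((nSYT (partseq f)) ^ 2)%:R / n`!%:R) *: wronskian_appell A (partseq f) =
  (num_tableaux n f)%:R * \det (jacobi_trudi a (fun i => f i)).
Proof.
move=> pf; rewrite (wronskian_appell_partseq pf) nSYT_partseq //.
rewrite /wronskian_appell vandermonde_partvals Wronskian_partvals !scalerA.
rewrite -polyC_natr mul_polyC; congr (_ *: _).
have := pf; rewrite is_partnE => /(num_tableaux_schur b0 bS (leqnn n)).
rewrite natrX; set N := (num_tableaux _ _)%:R; set D := \det _; set P := \prod_j _.
have P0 : P != 0 by apply/prodf_neq0 => j _; rewrite natR_neq0 ?fact_gt0.
have fact0 : n`!%:R != 0 :> R by rewrite natR_neq0 ?fact_gt0.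
(* If [D = 0], the count [N = n! D] is zero too and both sides vanish. *)
have [-> | D0] := eqVneq D 0; first by rewrite mulr0 => ->; rewrite expr0n !mul0r.
by move=> ->; field; rewrite P0 D0 fact0.
Qed.

End Appell.

(** * The Plancherel average *)

Theorem theorem5p2 (R : fieldType) (A : nat -> {poly R}) (n : nat) :
  [pchar R] =i pred0 ->
  appell A ->
  \sum_(f : {ffun 'I_n -> 'I_n.+1} | is_partn f)
      (((nSYT (partseq f)) ^ 2)%:R / (n`!)%:R) *: wronskian_appell A (partseq f)
  = A 1%N ^+ n.
Proof.
move=> pcharR appA; have [A0 _] := appA.
pose a m : {poly R} := (m`!%:R)^-1 *: A m.
have a0 : a 0%N = 1 by rewrite /a A0 invr1 scale1r.
have <- : a 1%N = A 1%N by rewrite /a invr1 scale1r.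
rewrite -(sum_num_tableaux_schur a0 (leqnn n)).
under eq_bigr => f pf do rewrite (plancherel_term pcharR appA pf).
by apply: eq_bigl => f; rewrite is_partnE.
Qed.
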